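(* Let $N = 2^L$ with $L \ge 1$ an integer, let $M, Y \in \mathbb{N}$, and let $r_0, r_1, \ldots, r_{L-1} \in \mathbb{N}_{>0}$. Consider parameters $\mathbf{a}^{0,j,\gamma} \in \mathbb{R}^M$ for $j \in [N]$, $\gamma \in [r_0]$; $\mathbf{a}^{l,j,\gamma} \in \mathbb{R}^{r_{l-1}}$ for $l \in [L-1]$, $j \in [N/2^l]$, $\gamma \in [r_l]$; and $\mathbf{a}^{L,y} \in \mathbb{R}^{r_{L-1}}$ for $y \in [Y]$. From these define recursively $$\phi^{1,j,\gamma} = \sum_{\alpha=1}^{r_0} a^{1,j,\gamma}_\alpha\, \mathbf{a}^{0,2j-1,\alpha} \otimes \mathbf{a}^{0,2j,\alpha}, \qquad j\in[N/2],\ \gamma\in[r_1],$$ $$\phi^{l,j,\gamma} = \sum_{\alpha=1}^{r_{l-1}} a^{l,j,\gamma}_\alpha\, \phi^{l-1,2j-1,\alpha} \otimes \phi^{l-1,2j,\alpha}, \qquad 2\le l\le L-1,\ j\in[N/2^l],\ \gamma\in[r_l],$$ $$\mathcal{A}^y = \sum_{\alpha=1}^{r_{L-1}} a^{L,y}_\alpha\, \phi^{L-1,1,\alpha} \otimes \phi^{L-1,2,\alpha}, \qquad y\in[Y],$$ (when $L=1$, $\mathcal{A}^y=\sum_{\alpha=1}^{r_0}a^{1,y}_\alpha\,\mathbf{a}^{0,1,\alpha}\otimes\mathbf{a}^{0,2,\alpha}$), so that each $\mathcal{A}^y$ is a tensor of order $N$ with dimension $M$ in each mode. Let $r := \min\{r_0,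 M\}$ and fix $y\in[Y]$. Then, in the Euclidean space of all parameter configurations $\{\mathbf{a}^{l,j,\gamma}\}_{l,j,\gamma}$ (all the parameters above), the set of configurations for which the CP-rank of $\mathcal{A}^y$ is less than $r^{N/2}$ has Lebesgue measure zero. The same conclusion holds in the ''shared'' setting: if one imposes $\mathbf{a}^{l,j,\gamma} = \mathbf{a}^{l,\gamma}$ for all $j$ (for each $l \in \{0,\ldots,L-1\}$ and $\gamma \in [r_l]$), and considers the Euclidean space of configurations of $\{\mathbf{a}^{l,\gamma}\}_{l,\gamma}$ together with $\{\mathbf{a}^{L,y}\}_y$, then the set of configurations for which the CP-rank of $\mathcal{A}^y$ is less than $r^{N/2}$ has Lebesgue measure zero.
   Context: For $k\in\mathbb{N}$, $[k]=\{1,\ldots,k\}$. The tensor product of tensors $\mathcal{A}$ (order $P$) and $\mathcal{B}$ (order $Q$) is the order-$(P+Q)$ tensor $(\mathcal{A}\otimes\mathcal{B})_{d_1\ldots d_{P+Q}} = \mathcal{A}_{d_1\ldots d_P}\mathcal{B}_{d_{P+1}\ldots d_{P+Q}}$. The CP-rank of a tensor $\mathcal{A}$ of order $N$ is the minimal $Z$ such that $\mathcal{A} = \sum_{z=1}^Z \mathbf{v}^{(1)}_z \otimes \cdots \otimes \mathbf{v}^{(N)}_z$ for some vectors $\mathbf{v}^{(i)}_z$. For a vector $\mathbf{a}$, $a_\alpha$ denotes its $\alpha$-th entry. Measure is Lebesgue measure on the Euclidean parameter space. *)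

(* Defs.v *)
From mathcomp Require Import all_boot all_order all_algebra.
From mathcomp Require Import boolp reals.
Set Implicit Arguments. Unset Strict Implicit. Unset Printing Implicit Defensive.
Import Order.TTheory GRing.Theory Num.Theory.
Local Open Scope ring_scope.

Definition tensor (R : realType) (M n : nat) := {ffun 'I_n -> 'I_M} -> R.

Definition tprod (R : realType) (M p q : nat) (A : tensor R M p) (B : tensor R M q)
  : tensor R M (p + q) :=
  fun d => A [ffun i => d (lshift q i)] * B [ffun i => d (rshift p i)].

Definition tcast (R : realType) (M m n : nat) (e : m = n) (A : tensor R M m)
  : tensor R M n :=
  fun d => A [ffun i => d (cast_ord e i)].

Lemma expn2S (l : nat) : (2 ^ l + 2 ^ l = 2 ^ l.+1)%N.
Proof. by rewrite expnS mul2n addnn. Qed.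

Definition cp_decomp (R : realType) (M n : nat) (A : tensor R M n) (Z : nat) : Prop :=
  exists v : 'I_Z -> 'I_n -> 'I_M -> R,
    forall d, A d = \sum_(z < Z) \prod_(i < n) v z i (d i).

Lemma cp_decomp_ex (R : realType) (M n : nat) (A : tensor R M n) :
  (exists Z, cp_decomp A Z) -> exists Z, `[< cp_decomp A Z >].
Proof. by move=> [Z hZ]; exists Z; apply/asboolP. Qed.

(* CP-rank = minimal Z admitting a CP decomposition (a decomposition always
   exists for tensors of positive order; the default 0 is never used here). *)
Definition cp_rank (R : realType) (M n : nat) (A : tensor R M n) : nat :=
  match pselect (exists Z, cp_decomp A Z) with
  | left h => ex_minn (cp_decomp_ex h)
  | right _ => 0%N
  end.

(* w l j g a = a^{l,j,g}_a  (all indices 0-based; the paper's j-th child pair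
   (2j-1, 2j) becomes (2j, 2j+1)).  The top-layer weights a^{L,y} are stored as
   w L 0 y (layer L has N/2^L = 1 node, and y plays the role of gamma).
   htensor w l j g  is phi^{l,j,g}, of order 2^l; phi^{0,j,g} is the vector
   a^{0,j,g} viewed as an order-1 tensor, and  A^y = htensor w L 0 y. *)
Fixpoint htensor (R : realType) (M : nat) (r : nat -> nat)
    (w : nat -> nat -> nat -> nat -> R) (l j g : nat) {struct l} : tensor R M (2 ^ l) :=
  match l as l0 return tensor R M (2 ^ l0) with
  | 0 => fun d => w 0%N j g (d (Ordinal (isT : (0 < 2 ^ 0)%N)))
  | l'.+1 => tcast (expn2S l')
      (fun d => \sum_(a < r l')
         w l'.+1 j g a * tprod (@htensor R M r w l' (2 * j) a)
                               (@htensor R M r w l' (2 * j).+1 a) d)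
  end.
Arguments htensor {R} M r w l j g.

Definition tnat (n : nat) (t : 'I_n * 'I_n * 'I_n * 'I_n) : nat * nat * nat * nat :=
  let: (l, j, g, a) := t in (nat_of_ord l, nat_of_ord j, nat_of_ord g, nat_of_ord a).

Definition pidx (n : nat) (P : pred (nat * nat * nat * nat)) : finType :=
  {t : 'I_n * 'I_n * 'I_n * 'I_n | P (tnat t)}.

Definition pget (R : realType) (n : nat) (P : pred (nat * nat * nat * nat))
    (p : pidx n P -> R) (l j g a : nat) : R :=
  match (insub l : option 'I_n), (insub j : option 'I_n),
        (insub g : option 'I_n), (insub a : option 'I_n) with
  | Some l', Some j', Some g', Some a' =>
      oapp p 0 (insub (l', j', g', a') : option (pidx n P))
  | _, _, _, _ => 0
  end.

Definition pbound (L M Y : nat) (r : nat -> nat) : nat :=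
  (2 ^ L + M + Y + \sum_(l < L) r l).+1.

(* Full (unshared) parameters:
   l = 0          : a^{0,j,g}_a,  j < N = 2^L, g < r_0, a < M
   1 <= l <= L-1  : a^{l,j,g}_a,  j < N/2^l,   g < r_l, a < r_{l-1}
   l = L          : a^{L,y}_a,    j = 0, y = g < Y,     a < r_{L-1}  *)
Definition pvalid (L M Y : nat) (r : nat -> nat) : pred (nat * nat * nat * nat) :=
  fun t => let: (l, j, g, a) := t in
  if l == 0%N then [&& j < 2 ^ L, g < r 0%N & a < M]%N
  else [&& l <= L, j < 2 ^ (L - l), g < (if l == L then Y else r l) & a < r l.-1]%N.

(* Shared parameters a^{l,g} (no j index, encoded as j = 0) for l < L, plus
   the top-layer a^{L,y}. *)
Definition pvalid_shared (L M Y : nat) (r : nat -> nat) : pred (nat * nat * nat * nat) :=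
  fun t => let: (l, j, g, a) := t in
  if l == 0%N then [&& j == 0%N, g < r 0%N & a < M]%N
  else [&& l <= L, j == 0%N, g < (if l == L then Y else r l) & a < r l.-1]%N.

Definition full_params (L M Y : nat) (r : nat -> nat) : finType :=
  pidx (pbound L M Y r) (pvalid L M Y r).
Definition shared_params (L M Y : nat) (r : nat -> nat) : finType :=
  pidx (pbound L M Y r) (pvalid_shared L M Y r).

Definition Ay_full (R : realType) (L M Y : nat) (r : nat -> nat)
    (p : full_params L M Y r -> R) (y : nat) : tensor R M (2 ^ L) :=
  htensor M r (fun l j g a => pget p l j g a) L 0 y.

Definition Ay_shared (R : realType) (L M Y : nat) (r : nat -> nat)
    (p : shared_params L M Y r -> R) (y : nat) : tensor R M (2 ^ L) :=
  htensor M r (fun l _ g a => pget p l 0 g a) L 0 y.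

Definition lebesgue_null (R : realType) (I : finType) (S : (I -> R) -> Prop) : Prop :=
  forall eps : R, 0 < eps ->
  exists a b : nat -> I -> R,
    (forall k i, a k i <= b k i) /\
    (forall x, S x -> exists k, forall i, a k i <= x i <= b k i) /\
    (forall n, \sum_(k < n) \prod_(i : I) (b k i - a k i) <= eps).

(* Main.v *)
(* Merging the even modes into rows and the odd modes into columns, and keeping
   only indices below [r = minn (r 0) M], turns an order-[N] tensor of CP-rank [Z]
   into a square matrix of size [r ^ (N / 2)] and rank at most [Z].  So a CP-rank
   below [r ^ (N / 2)] forces the determinant of this matrix, a polynomial in the
   parameters, to vanish.  For one explicit (shared) parameter choice the matrix is
   the identity, hence the polynomial is nonzero and its zero set is null.
   That last fact is proved by induction on the degree: where some partial
   derivative is nonzero, the zero set is locally a Lipschitz graph, which thin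
   boxes over a fine grid cover with arbitrarily small volume; elsewhere that
   derivative, of smaller degree, vanishes. *)
Require Import Defs.
From mathcomp Require Import all_boot all_order all_algebra.
From mathcomp Require Import boolp reals.
From mathcomp Require Import ring lra zify.
From mathcomp Require Import mpoly.
Set Implicit Arguments. Unset Strict Implicit. Unset Printing Implicit Defensive.
Import Order.TTheory GRing.Theory Num.Theory.
Local Open Scope ring_scope.

(** * Null sets *)

Lemma ler_sum_uniq (R : numDomainType) (T : eqType) (F : T -> R) (s s' : seq T) :
  (forall t, 0 <= F t) -> uniq s -> {subset s <= s'} ->
  \sum_(t <- s) F t <= \sum_(t <- s') F t.
Proof.
move=> F0 us ss'; apply: (@le_trans _ _ (\sum_(t <- undup s') F t)).
  have p : perm_eq s [seq t <- undup s' | t \in s].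
    apply: uniq_perm => //; first by rewrite filter_uniq ?undup_uniq.
    by move=> t; rewrite mem_filter mem_undup; case: (boolP (t \in s)) => // /ss' ->.
  rewrite (perm_big _ p) big_filter big_mkcond; apply: ler_sum => t _.
  by case: ifP.
elim: s' {ss'} => [|x s' IH] /=; first by rewrite big_nil.
case: ifP => _; rewrite !big_cons ?lerD2l //.
by apply: le_trans IH _; rewrite lerDr.
Qed.

(** Distinct elements have distinct codes, so a finite piece of a geometric series dominates the
    sum. These weights share out [eps] over a countable family. *)
Lemma sum_half_pickle_le1 (R : realFieldType) (T : countType) (s : seq T) :
  uniq s -> \sum_(t <- s) (2^-1 : R) ^+ (pickle t).+1 <= 1.
Proof.
move=> us; pose n := (\max_(t <- s) pickle t).+1.
have geo m : \sum_(k <- iota 0 m) (2^-1 : R) ^+ k.+1 = 1 - 2^-1 ^+ m.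
  elim: m => [|m IH]; first by rewrite big_nil expr0 subrr.
  rewrite -addn1 iotaD big_cat big_seq1 IH add0n addn1 exprS.
  by move: (2^-1 ^+ m) => x /=; field.
rewrite -(big_map (fun t : T => pickle t) xpredT (fun k => (2^-1 : R) ^+ k.+1)).
apply: le_trans (_ : \sum_(k <- iota 0 n) (2^-1 : R) ^+ k.+1 <= _).
  apply: ler_sum_uniq => [k||k /mapP[t ts ->]].
  - by rewrite exprn_ge0 // invr_ge0.
  - by rewrite map_inj_uniq //; apply: (pcan_inj pickleK).
  - by rewrite mem_iota /= /n ltnS; apply: leq_bigmax_seq.
by rewrite geo lerBlDr lerDl exprn_ge0 // invr_ge0.
Qed.

Section NullSets.
Variables (R : realType) (I : finType).
Implicit Types (S : (I -> R) -> Prop) (x : I -> R).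

Lemma lebesgue_nullS S S' :
  (forall x, S x -> S' x) -> lebesgue_null S' -> lebesgue_null S.
Proof.
move=> SS' N eps /N [a [b [ab [cov sm]]]]; exists a, b.
by split=> //; split=> // x /SS' /cov.
Qed.

(* The element [i0] is needed: over an empty index type every box has volume [1],
   so that no set is null. *)
Lemma lebesgue_null_countable_cover (i0 : I) S :
  (forall eps : R, 0 < eps -> exists (T : countType) (a b : T -> I -> R),
    [/\ forall t i, a t i <= b t i,
        forall x, S x -> exists t, forall i, a t i <= x i <= b t i &
        forall s, uniq s -> \sum_(t <- s) \prod_i (b t i - a t i) <= eps]) ->
  lebesgue_null S.
Proof.
move=> N eps /N [T [a [b [ab cov sm]]]].
(* A number that codes no element of [T] gets the point box at the origin, whose volume vanishes
   through the factor at [i0]. *)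
exists (fun k i => oapp (a^~ i) 0 (@pickle_inv T k)),
       (fun k i => oapp (b^~ i) 0 (@pickle_inv T k)).
split=> [k i|]; first by case: pickle_inv => //=.
split=> [x /cov [t ht]|n].
  by exists (pickle t) => i; rewrite pickleK_inv /=.
apply: le_trans (sm (pmap (@pickle_inv T) (iota 0 n)) _); last first.
  by apply: (pmap_uniq (@pickle_invK T)); rewrite iota_uniq.
rewrite -(big_mkord xpredT (fun k => \prod_i
  (oapp (b^~ i) 0 (@pickle_inv T k) - oapp (a^~ i) 0 (@pickle_inv T k)))).
rewrite /index_iota subn0; elim: (iota 0 n) => [|k s IH]; first by rewrite !big_nil.
rewrite big_cons /=; case: (@pickle_inv T k) => [t|] /=.
  by rewrite big_cons lerD2l.
by rewrite (bigD1 i0) //= subrr mul0r add0r.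
Qed.

(** Each [S t] gets the budget [eps / 2 ^ (pickle t + 1)]; the boxes are indexed by pairs in
    [T * nat]. *)
Lemma lebesgue_null_bigcup (i0 : I) (T : countType) (S : T -> (I -> R) -> Prop) :
  (forall t, lebesgue_null (S t)) -> lebesgue_null (fun x => exists t, S t x).
Proof.
move=> N; apply: (lebesgue_null_countable_cover i0) => eps eps0.
have epst t : 0 < eps * 2^-1 ^+ (@pickle T t).+1.
  by rewrite mulr_gt0 // exprn_gt0 // invr_gt0.
have /choice [ab abP] t : exists ab : (nat -> I -> R) * (nat -> I -> R),
    [/\ forall k i, ab.1 k i <= ab.2 k i,
        forall x, S t x -> exists k, forall i, ab.1 k i <= x i <= ab.2 k i &
        forall n, \sum_(k < n) \prod_i (ab.2 k i - ab.1 k i)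
                    <= eps * 2^-1 ^+ (@pickle T t).+1].
  by have [a [b [? [? ?]]]] := N t _ (epst t); exists (a, b).
exists (T * nat)%type, (fun u => (ab u.1).1 u.2), (fun u => (ab u.1).2 u.2).
split=> [[t k] i|x [t Stx]|s us] /=.
- by have [->] := abP t.
- by have [_ /(_ _ Stx) [k hk] _] := abP t; exists (t, k).
pose V t k := \prod_i ((ab t).2 k i - (ab t).1 k i).
have V0 t k : 0 <= V t k.
  by apply: prodr_ge0 => i _; rewrite subr_ge0; have [->] := abP t.
(* The finite set of pairs is enclosed in a rectangle, so that the volume bound of each single cover
   applies. *)
pose n := (\max_(u <- s) u.2).+1.
pose s1 := undup (map fst s).
apply: (@le_trans _ _ (\sum_(u <- [seq (t, k) | t <- s1, k <- iota 0 n]) V u.1 u.2)).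
  apply: ler_sum_uniq => [u|//|[t k] tks]; first exact: V0.
  apply/allpairsP; exists (t, k); split=> //.
    by rewrite mem_undup; apply/mapP; exists (t, k).
  by rewrite mem_iota /= /n ltnS; apply: (leq_bigmax_seq (t, k)).
rewrite big_allpairs_dep /=.
apply: (@le_trans _ _ (\sum_(t <- s1) eps * 2^-1 ^+ (@pickle T t).+1)).
  apply: ler_sum => t _; have [_ _ /(_ n)] := abP t.
  by rewrite -(big_mkord xpredT (V t)) /index_iota subn0.
rewrite -big_distrr /= ger_pMr //.
by apply: sum_half_pickle_le1; rewrite undup_uniq.
Qed.

Lemma lebesgue_null_or (i0 : I) S S' :
  lebesgue_null S -> lebesgue_null S' -> lebesgue_null (fun x => S x \/ S' x).
Proof.
move=> N N'.
apply: (@lebesgue_nullS _ (fun x => exists b : bool, if b then S x else S' x)).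
  by move=> x [h|h]; [exists true | exists false].
by apply: (lebesgue_null_bigcup i0); case.
Qed.

(** Cut every axis of the cube except [i] into [m.+1] intervals of length [e]. Over one cell the
    [i]-th coordinate of points of [S] stays within [C * e] of a single value, so one thin box per
    cell suffices, for a total volume of [K / m.+1]. *)
Lemma lebesgue_null_lipschitz (i : I) (c : I -> R) (h C : R) S :
  0 < h -> 0 <= C ->
  (forall x, S x -> forall j, c j <= x j <= c j + h) ->
  (forall x y d, 0 <= d -> S x -> S y -> (forall j, j != i -> `|x j - y j| <= d) ->
     `|x i - y i| <= C * d) ->
  lebesgue_null S.
Proof.
move=> h0 C0 Sbox Slip; apply: (lebesgue_null_countable_cover i) => eps eps0.
pose K := 2 * C * h * h ^+ #|predC1 i|.
have [m Km] : exists m : nat, K / m.+1%:R <= eps.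
  exists (Num.bound `|K / eps|); rewrite ler_pdivrMr ?ltr0n // mulrC -ler_pdivrMr //.
  apply: ltW; apply: le_lt_trans (ler_norm _) _.
  by apply: lt_le_trans (archi_boundP (normr_ge0 _)) _; rewrite ler_nat.
pose e := h / m.+1%:R.
have e0 : 0 < e by rewrite divr_gt0 ?ltr0n.
pose T : countType := {ffun I -> 'I_m.+1}.
pose Col (t : T) x := S x /\ forall j, j != i ->
  c j + e *+ t j <= x j <= c j + e *+ (t j).+1.
have /choice [z zP] (t : T) : exists z : R, forall x, Col t x -> `|x i - z| <= C * e.
  case: (pselect (exists x, Col t x)) => [[y [Sy hy]]|nC]; last first.
    by exists 0 => x Cx; case: nC; exists x.
  exists (y i) => x [Sx hx]; apply: Slip => // [|j ji]; first exact: ltW.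
  move: (hx j ji) (hy j ji); rewrite !mulrS => /andP[? ?] /andP[? ?].
    by rewrite ler_norml; apply/andP; split; lra.
(* Cells are indexed by functions on all of [I], so each occurs [m.+1] times; the copies with [t i]
   nonzero get flat boxes of volume 0. *)
pose w (t : T) := if t i == ord0 then C * e else 0.
have w0 t : 0 <= w t by rewrite /w; case: ifP => // _; rewrite mulr_ge0 // ltW.
exists T, (fun t j => if j == i then z t - w t else c j + e *+ t j),
          (fun t j => if j == i then z t + w t else c j + e *+ (t j).+1).
split=> [t j|x Sx|s us].
- case: ifP => _; first by have := w0 t; lra.
  by rewrite mulrS; lra.
- have /choice [k kP] j : exists k : 'I_m.+1,
      if j == i then k = ord0 else c j + e *+ k <= x j <= c j + e *+ k.+1.
    case: eqP => [_|_]; first by exists ord0.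
    have /andP[xl xr] := Sbox _ Sx j.
    pose u := (x j - c j) / e.
    have u0 : 0 <= u by rewrite divr_ge0 ?subr_ge0 // ltW.
    have xu : x j = c j + e * u by rewrite /u; field; rewrite gt_eqF.
    have um : u <= m.+1%:R.
      by rewrite ler_pdivrMr // /e mulrC divfK ?pnatr_eq0 //; lra.
    have /andP[tl tr] := truncn_itv u0.
    (* The minimum handles the right end [x j = c j + h], where [u] truncates to [m.+1]. *)
    exists (inord (minn (Num.truncn u) m)).
    rewrite inordK ?ltnS ?geq_minr // xu -!(mulr_natr e) !lerD2l !ler_pM2l //.
    have [_|tm] := leqP (Num.truncn u) m; first by rewrite tl ltW.
    rewrite um andbT; apply: le_trans tl; rewrite ler_nat; exact: ltnW.
  exists [ffun j => k j] => j.
  case: (eqVneq j i) => [->|ji]; last by have := kP j; rewrite (negPf ji) ffunE.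
  have -> : w [ffun j => k j] = C * e.
    by rewrite /w ffunE; have := kP i; rewrite eqxx => ->; rewrite eqxx.
  have : `|x i - z [ffun j => k j]| <= C * e.
    apply: zP; split=> // l li; have := kP l.
    by rewrite (negPf li) ffunE.
  by rewrite ler_norml => /andP[? ?]; apply/andP; split; lra.
(* Each side length depends on a single [t j], so the sum over all cells factors into a product of
   sums. *)
- pose F j (k : 'I_m.+1) := if j == i then (if k == ord0 then C * e *+ 2 else 0) else e.
  have F0 j k : 0 <= F j k.
    rewrite /F; case: ifP => _; last exact: ltW.
    by case: ifP => // _; rewrite mulrn_wge0 // mulr_ge0 // ltW.
  apply: (@le_trans _ _ (\sum_(t : {ffun I -> 'I_m.+1}) \prod_j F j (t j))).
    rewrite (eq_bigr (fun t : T => \prod_j F j (t j))) => [|t _]; last first.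
      apply: eq_bigr => j _; rewrite /F; case: eqP => [->|_].
        by rewrite /w; case: ifP => _; rewrite ?mulr2n; lra.
      by rewrite mulrS; lra.
    apply: ler_sum_uniq => // [t|t _]; first exact: prodr_ge0.
    by rewrite mem_index_enum.
  rewrite -bigA_distr_bigA (bigD1 i) //=.
  have -> : \prod_(j | j != i) \sum_k F j k = h ^+ #|predC1 i|.
    rewrite -prodr_const; apply: eq_bigr => j ji.
    rewrite /F (negPf ji) sumr_const card_ord /e.
    by rewrite -[LHS]mulr_natr divfK // pnatr_eq0.
  rewrite (bigD1 ord0) //= big1 => [|k k0]; last first.
    by rewrite /F eqxx (negPf k0).
  rewrite addr0 /F !eqxx.
  apply: le_trans Km; rewrite /K /e le_eqVlt; apply/orP; left; apply/eqP.
  have : m.+1%:R != 0 :> R by rewrite pnatr_eq0.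
  move: (h ^+ _) (m.+1%:R : R) => X n n0.
  by rewrite mulr2n; field.
Qed.

End NullSets.

(** * Zeros of polynomials *)

Section MpolyZeros.
Variables (R : realType) (n : nat).
Implicit Types (p q : {mpoly R[n]}) (x y : 'I_n -> R).

(** The three estimates are bundled because those for a product with a variable mix them. *)
Definition taylor_bound (K : R) p (B : R) := forall x y (d : R), 0 <= d ->
  (forall j, `|x j| <= K) -> (forall j, `|y j| <= K) ->
  (forall j, `|x j - y j| <= d) ->
  [/\ `|p.@[x]| <= B, `|p.@[x] - p.@[y]| <= B * d &
      `|p.@[x] - p.@[y] - \sum_j p^`M(j).@[y] * (x j - y j)| <= B * d ^+ 2].

Definition taylor_bounded (K : R) p := exists2 B : R, 0 <= B & taylor_bound K p B.

Lemma taylor_boundedC K (c : R) : taylor_bounded K c%:MP_[n].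
Proof.
exists `|c| => // x y d d0 _ _ _; rewrite !mevalC subrr normr0; split=> //.
  exact: mulr_ge0.
rewrite big1 => [|j _]; last by rewrite mderivC meval0 mul0r.
by rewrite subr0 normr0 mulr_ge0 // exprn_ge0.
Qed.

Lemma taylor_boundedD K p q :
  taylor_bounded K p -> taylor_bounded K q -> taylor_bounded K (p + q).
Proof.
move=> [B B0 hB] [C C0 hC]; exists (B + C); first exact: addr_ge0.
move=> x y d d0 xK yK xyd.
have [p1 p2 p3] := hB x y d d0 xK yK xyd; have [q1 q2 q3] := hC x y d d0 xK yK xyd.
rewrite !mevalD; split.
- exact: le_trans (ler_normD _ _) (lerD p1 q1).
- rewrite mulrDl; apply: le_trans (lerD p2 q2); apply: le_trans (ler_normD _ _).
  rewrite le_eqVlt; apply/orP; left; apply/eqP; congr `|_|.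
  by move: p.@[x] q.@[x] p.@[y] q.@[y] => *; ring.
- rewrite (eq_bigr (fun j => p^`M(j).@[y] * (x j - y j) + q^`M(j).@[y] * (x j - y j)));
    last by move=> j _; rewrite mderivD mevalD mulrDl.
  rewrite big_split /= mulrDl; apply: le_trans (lerD p3 q3).
  apply: le_trans (ler_normD _ _).
  set s1 := \sum_j _; set s2 := \sum_j _.
  rewrite le_eqVlt; apply/orP; left; apply/eqP; congr `|_|.
  by move: p.@[x] q.@[x] p.@[y] q.@[y] s1 s2 => *; ring.
Qed.

Lemma taylor_boundedZ K (c : R) p : taylor_bounded K p -> taylor_bounded K (c *: p).
Proof.
move=> [B B0 hB]; exists (`|c| * B); first exact: mulr_ge0.
move=> x y d d0 xK yK xyd; have [p1 p2 p3] := hB x y d d0 xK yK xyd.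
rewrite !mevalZ -!mulrA; split.
- by rewrite normrM ler_wpM2l.
- by rewrite -mulrBr normrM ler_wpM2l.
- rewrite (eq_bigr (fun j => c * (p^`M(j).@[y] * (x j - y j)))); last first.
    by move=> j _; rewrite mderivZ mevalZ mulrA.
  by rewrite -big_distrr /= -!mulrBr normrM ler_wpM2l.
Qed.

(** By the Leibniz rule for increments, the term with factor [x i] or [y i] costs [K] and the one
    with factor [x i - y i] costs [d], whence [K + 1]. *)
Lemma taylor_boundedMX K p i : 0 <= K -> taylor_bounded K p -> taylor_bounded K (p * 'X_i).
Proof.
move=> K0 [B B0 hB]; exists (B * (K + 1)); first by rewrite mulr_ge0 // addr_ge0.
move=> x y d d0 xK yK xyd; have [p1 p2 p3] := hB x y d d0 xK yK xyd.
have [q1 _ _] := hB y x d d0 yK xK (fun j => eq_ind_r (fun z => z <= d) (xyd j) (distrC _ _)).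
rewrite !mevalM !mevalXU; split.
- by rewrite normrM; apply: ler_pM => //; apply: le_trans (xK i) _; rewrite lerDl.
- have -> : p.@[x] * x i - p.@[y] * y i
    = (p.@[x] - p.@[y]) * x i + p.@[y] * (x i - y i).
    by move: p.@[x] p.@[y] => *; ring.
  apply: le_trans (ler_normD _ _) _; rewrite !normrM.
  have -> : B * (K + 1) * d = (B * d) * K + B * d by ring.
  by apply: lerD; apply: ler_pM.
- rewrite (eq_bigr (fun j => y i * (p^`M(j).@[y] * (x j - y j)) +
      p.@[y] * (if j == i then x i - y i else 0))); last first.
    move=> j _; rewrite mderivM mevalD !mevalM mevalXU mderivX mevalZ mnm1E mevalX.
    move: p.@[y] p^`M(j).@[y] => a b.
    rewrite eq_sym; case: eqP => [->|_] /=; last by ring.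
    rewrite big1 => [|l _]; last by rewrite mnmBE subnn expr0.
    by ring.
  rewrite big_split /= -!big_distrr /= -big_mkcond big_pred1_eq.
  set s := \sum_j _.
  have -> : p.@[x] * x i - p.@[y] * y i - (y i * s + p.@[y] * (x i - y i))
    = (p.@[x] - p.@[y] - s) * y i + (p.@[x] - p.@[y]) * (x i - y i).
    by move: p.@[x] p.@[y] s => *; ring.
  apply: le_trans (ler_normD _ _) _; rewrite !normrM.
  have -> : B * (K + 1) * d ^+ 2 = (B * d ^+ 2) * K + (B * d) * d by ring.
  by apply: lerD; apply: ler_pM.
Qed.

Lemma mpoly_taylor_bounded K p : 0 <= K -> taylor_bounded K p.
Proof.
move=> K0; elim/mpolyind: p => [|c m p _ _ hp]; first exact: taylor_boundedC.
apply: taylor_boundedD hp; apply: taylor_boundedZ.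
(* The accumulator [p'] lets a monomial be built from 1, one variable at a time. *)
suff H l p' : taylor_bounded K p' ->
    taylor_bounded K (p' * \prod_(i <- l) 'X_i ^+ m i).
  rewrite mpolyXE_id -[X in taylor_bounded _ X]mul1r -mpolyC1.
  exact/H/taylor_boundedC.
elim: l p' => [|i l IHl] p' hp'; first by rewrite big_nil mulr1.
rewrite big_cons mulrA; apply: IHl.
elim: (m i) => [|k IHk]; first by rewrite expr0 mulr1.
by rewrite exprSr mulrA; apply: taylor_boundedMX.
Qed.

(** A quantitative implicit function theorem: between two zeros, Taylor's formula bounds the linear
    term in direction [i] by the other linear terms plus a quadratic remainder. On small cubes the
    remainder is absorbed, so coordinate [i] is Lipschitz in the others. *)
Lemma lebesgue_null_mpoly_regular p i :
  lebesgue_null (fun x : 'I_n -> R => p.@[x] = 0 /\ p^`M(i).@[x] != 0).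
Proof.
(* On each of these countably many pieces the constants below are uniform. *)
pose S (k : nat) x := [/\ forall j, `|x j| <= k%:R, p.@[x] = 0 &
  k.+1%:R^-1 <= `|p^`M(i).@[x]|].
apply: (@lebesgue_nullS _ _ _ (fun x => exists k, S k x)) => [x [px dpx]|].
  have g0 : 0 < `|p^`M(i).@[x]| by rewrite normr_gt0.
  pose k := (\max_j Num.bound (`|x j|) + Num.bound (`|p^`M(i).@[x]|^-1))%N.
  exists k; split=> // [j|].
    apply: ltW; apply: lt_le_trans (archi_boundP (normr_ge0 _)) _.
    by rewrite ler_nat; apply: leq_trans (leq_addr _ _); apply: (leq_bigmax j).
  rewrite invf_ple ?posrE ?ltr0n //; apply: ltW.
  apply: lt_le_trans (archi_boundP _) _; first by rewrite invr_ge0.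
  by rewrite ler_nat leqW // leq_addl.
apply: (lebesgue_null_bigcup i) => k.
have [B B0 hB] := mpoly_taylor_bounded p (ler0n R k).
have /choice [D hD] j : exists D : R, 0 <= D /\ forall x,
    (forall l, `|x l| <= k%:R) -> `|p^`M(j).@[x]| <= D.
  have [D D0 hD] := mpoly_taylor_bounded p^`M(j) (ler0n R k).
  exists D; split=> // x xk.
  by case: (hD x x 0 (lexx _) xk xk) => // l; rewrite subrr normr0.
pose c : R := k.+1%:R^-1.
have c0 : 0 < c by rewrite invr_gt0 ltr0n.
pose m := Num.bound (2 * B / c).
pose h : R := m.+1%:R^-1.
have h0 : 0 < h by rewrite invr_gt0 ltr0n.
(* On a cube of side [h] the quadratic Taylor remainder is dominated by half
   of the linear term in the direction [i]. *)
have Bh : 2 * B * h <= c.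
  rewrite ler_pdivrMr ?ltr0n // -ler_pdivrMl // [X in X <= _]mulrC.
  apply: ltW; apply: lt_le_trans (archi_boundP _) _; last by rewrite ler_nat.
  by rewrite !mulr_ge0 // invr_ge0 ltW.
pose E := \sum_(j | j != i) D j.
have E0 : 0 <= E by apply: sumr_ge0 => j _; have [] := hD j.
apply: (@lebesgue_nullS _ _ _ (fun x => exists q : {ffun 'I_n -> int}, S k x /\
    forall j, (q j)%:~R * h <= x j <= (q j)%:~R * h + h)).
  move=> x Sx; exists [ffun j => Num.floor (x j / h)]; split=> // j; rewrite ffunE.
  have /andP[fl fr] := floor_itv (x j / h).
  rewrite -ler_pdivlMr // fl /= -[X in _ + X]mul1r -mulrDl -ler_pdivrMr //.
  by rewrite ltW // -[1]/(1%:~R) -rmorphD.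
apply: (lebesgue_null_bigcup i) => q.
(* The slope [2 * E / c] comes from Taylor's formula when [|x i - y i|] exceeds [d]; the [+ 1]
   covers the other case. *)
apply: (@lebesgue_null_lipschitz _ _ i (fun j => (q j)%:~R * h) h (2 * E / c + 1)) => //.
- by rewrite addr_ge0 // divr_ge0 ?mulr_ge0 // ltW.
- by move=> x [].
move=> x y d d0 [[xk px gx] xq] [[yk py gy] yq] xyd.
set t := `|x i - y i|.
have C1 : d <= (2 * E / c + 1) * d.
  by rewrite mulrDl mul1r lerDr mulr_ge0 // divr_ge0 ?mulr_ge0 // ltW.
have [td|dt] := leP t d; first exact: le_trans td C1.
have th : t <= h.
  move: (xq i) (yq i) => /andP[? ?] /andP[? ?].
  by rewrite ler_norml; apply/andP; split; lra.
(* As [d < t], direction [i] has the largest increment, so Taylor's bound is used at scale [t]. *)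
have xyt j : `|x j - y j| <= t.
  by have [->//|ji] := eqVneq j i; apply: le_trans (xyd j ji) (ltW dt).
have [_ _] := hB x y t (normr_ge0 _) xk yk xyt.
rewrite px py subr0 sub0r normrN (bigD1 i) //=.
set s := \sum_(j | j != i) _ => ub.
have sE : `|s| <= E * d.
  rewrite mulr_suml; apply: le_trans (ler_norm_sum _ _ _) _; apply: ler_sum => j ji.
  by rewrite normrM ler_pM ?xyd //; have [_] := hD j; apply.
have ct : c * t <= `|p^`M(i).@[y] * (x i - y i)|.
  by rewrite normrM; apply: ler_wpM2r gy; apply: normr_ge0.
have : c * t <= B * t ^+ 2 + E * d.
  apply: le_trans ct _; rewrite -[X in `|X|](addrK s).
  apply: le_trans (ler_normB _ _) _; exact: lerD.
have : 2 * B * t ^+ 2 <= c * t.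
  have tc : 2 * B * t <= c by apply: le_trans Bh; rewrite ler_wpM2l // mulr_ge0.
  by rewrite expr2 mulrA; apply: ler_wpM2r tc; apply: normr_ge0.
move=> h1 h2; apply: (@le_trans _ _ (2 * E / c * d)); last by rewrite ler_wpM2r // lerDl.
have {}h1 : c * t <= 2 * E * d by lra.
by rewrite mulrAC ler_pdivlMr // mulrC.
Qed.

(* Away from the zeros of a nonzero partial derivative, which has lower degree,
   the zero set is a countable union of Lipschitz graphs. *)
Lemma lebesgue_null_mpoly_zeros (i0 : 'I_n) p :
  p != 0 -> lebesgue_null (fun x : 'I_n -> R => p.@[x] = 0).
Proof.
pose below k q := forall m, m \in msupp q -> (mdeg m < k)%N.
suff H k q : below k q -> q != 0 -> lebesgue_null (fun x : 'I_n -> R => q.@[x] = 0).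
  by apply: (H (msize p)) => m; apply: msize_mdeg_lt.
elim: k q => [|k IH] q qk q0.
  by case/negP: q0; rewrite -msupp_eq0; move: qk; rewrite /below;
     case: (msupp q) => // m l /(_ m (mem_head _ _)).
(* A nonzero constant has an empty zero set, a union over [void]. Otherwise some monomial [m]
   contains a variable in which to differentiate. *)
case: (boolP (all (pred1 0%MM) (msupp q))) => [/allP q1|/allPn [m mq m0]].
  have qC : q = (q@_0%MM)%:MP.
    apply/mpolyP => m; rewrite mcoeffC; have [->|m0] := eqVneq 0%MM m; first by rewrite mulr1.
    apply/eqP; rewrite mulr0 mcoeff_eq0; apply: contra m0 => /q1 /=.
    by rewrite eq_sym.
  apply: (@lebesgue_nullS _ _ _ (fun x => exists t : void, True)).
    move=> x; rewrite qC mevalC => /eqP q00; case/negP: q0.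
    by rewrite qC (eqP q00) mpolyC0.
  by apply: (lebesgue_null_bigcup i0); case.
have [i mi] : exists i, m i != 0%N.
  apply/existsP; apply: contraR m0; rewrite negb_exists => /forallP m0.
  apply/eqP/mnmP => i; rewrite mnm0E; apply/eqP; move: (m0 i); by rewrite negbK.
apply: (@lebesgue_nullS _ _ _ (fun x =>
    q^`M(i).@[x] = 0 \/ (q.@[x] = 0 /\ q^`M(i).@[x] != 0))).
  by move=> x qx; have [->|d0] := eqVneq (q^`M(i).@[x]) 0; [left|right].
apply: (lebesgue_null_or i0 _ (lebesgue_null_mpoly_regular q i)); apply: IH.
  move=> l; rewrite mcoeff_msupp mcoeff_deriv -mulr_natr mulf_eq0 negb_or => /andP[ql _].
  by move: ql; rewrite -mcoeff_msupp => /qk; rewrite mdegD mdeg1 addn1.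
(* The coefficient of the derivative at [m - U_(i)] is [m i] times that of [q] at [m], which is
   nonzero in characteristic 0. *)
apply/eqP => /mpolyP /(_ (m - U_(i))%MM); rewrite mcoeff_deriv mcoeff0 submK.
  by apply/eqP; rewrite mulrn_eq0 negb_or /= -mcoeff_msupp.
by rewrite lep1mP.
Qed.

End MpolyZeros.

(** * Polynomial functions on a finite-dimensional parameter space *)

Section PolynomialFunctions.
Variables (R : realType) (I : finType).
Implicit Types (f g : (I -> R) -> R).

Definition polyfun f := exists p : {mpoly R[#|I|]},
  forall x, f x = p.@[fun k => x (enum_val k)].

Lemma polyfun_cst c : polyfun (fun=> c).
Proof. by exists c%:MP => x; rewrite mevalC. Qed.

Lemma polyfun_coord i : polyfun (fun x => x i).
Proof. by exists 'X_(enum_rank i) => x; rewrite mevalXU enum_rankK. Qed.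

Lemma polyfunM f g : polyfun f -> polyfun g -> polyfun (fun x => f x * g x).
Proof. by move=> [p fp] [q gq]; exists (p * q) => x; rewrite mevalM fp gq. Qed.

Lemma polyfun_sum (T : Type) (s : seq T) (P : pred T) (F : T -> (I -> R) -> R) :
  (forall t, polyfun (F t)) -> polyfun (fun x => \sum_(t <- s | P t) F t x).
Proof.
move=> FP; elim: s => [|t s [p ps]].
  by exists 0 => x; rewrite big_nil meval0.
have [q qt] := FP t; exists ((if P t then q else 0) + p) => x.
by rewrite big_cons mevalD -ps; case: ifP; rewrite ?qt ?meval0 ?add0r.
Qed.

Lemma polyfun_prod (T : Type) (s : seq T) (P : pred T) (F : T -> (I -> R) -> R) :
  (forall t, polyfun (F t)) -> polyfun (fun x => \prod_(t <- s | P t) F t x).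
Proof.
move=> FP; elim: s => [|t s [p ps]].
  by exists 1 => x; rewrite big_nil meval1.
have [q qt] := FP t; exists ((if P t then q else 1) * p) => x.
by rewrite big_cons mevalM -ps; case: ifP; rewrite ?qt ?meval1 ?mul1r.
Qed.

Lemma polyfun_det m (A : (I -> R) -> 'M[R]_m) :
  (forall i j, polyfun (fun x => A x i j)) -> polyfun (fun x => \det (A x)).
Proof.
move=> AP; apply: polyfun_sum => s; apply: polyfunM; first exact: polyfun_cst.
by apply: polyfun_prod => i.
Qed.

Lemma lebesgue_null_enum (S : ('I_#|I| -> R) -> Prop) :
  lebesgue_null S -> lebesgue_null (fun x : I -> R => S (fun k => x (enum_val k))).
Proof.
move=> N eps /N [a [b [ab [cov sm]]]].
exists (fun k i => a k (enum_rank i)), (fun k i => b k (enum_rank i)).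
split=> //; split=> [x /cov [k hk]|m].
  by exists k => i; have := hk (enum_rank i); rewrite enum_rankK.
rewrite (eq_bigr (fun k : 'I_m => \prod_i (b k i - a k i))) => [|k _]; first exact: sm.
by rewrite (reindex _ (onW_bij _ (@enum_rank_bij I))).
Qed.

(** One point where [f] is nonzero makes the representing polynomial nonzero. *)
Lemma lebesgue_null_polyfun (i0 : I) f x0 :
  polyfun f -> f x0 != 0 -> lebesgue_null (fun x => f x = 0).
Proof.
move=> [p fp] fx0.
apply: (@lebesgue_nullS _ _ _ (fun x => p.@[fun k => x (enum_val k)] = 0)) => [x|].
  by rewrite fp.
apply: lebesgue_null_enum (fun y => p.@[y] = 0) _.
apply: lebesgue_null_mpoly_zeros (enum_rank i0) _ _.
by apply: contraNneq fx0 => p0; rewrite fp p0 meval0.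
Qed.

End PolynomialFunctions.

(** * Hierarchical tensors *)

Lemma cp_decomp_cp_rank (R : realType) (M n : nat) (A : tensor R M n) :
  (0 < n)%N -> cp_decomp A (cp_rank A).
Proof.
move=> n0; rewrite /cp_rank; case: pselect => [h|[]].
  by case: ex_minnP => Z /asboolP.
pose T : finType := {ffun 'I_n -> 'I_M}.
(* One elementary tensor per multi-index: basis vectors, with the entry of [A] scaling the one at
   mode 0. *)
exists #|T|; exists (fun z i a => (if i == Ordinal n0 then A (enum_val z) else 1) *
                        (enum_val z i == a)%:R) => d.
rewrite (bigD1 (enum_rank (d : T))) //= [X in _ + X]big1 => [|z zd].
  rewrite addr0 (bigD1 (Ordinal n0)) //= enum_rankK !eqxx mulr1 big1 ?mulr1 // => i.
  by move/negPf => ->; rewrite eqxx mulr1.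
have [i zi] : exists i, enum_val z i != d i.
  apply/existsP; rewrite -negb_forall; apply: contra zd => /forallP zd.
  apply/eqP; rewrite -[z]enum_valK; congr enum_rank; apply/ffunP => i; exact/eqP.
by rewrite (bigD1 i) //= (negPf zi) mulr0 mul0r.
Qed.

(** * Multi-indices constant on pairs of adjacent modes *)

Section Pairing.

Definition paired (T : eqType) (n : nat) (d : {ffun 'I_n -> T}) :=
  [forall i, forall k, ((val i)./2 == (val k)./2) ==> (d i == d k)].

Lemma pairedP (T : eqType) (n : nat) (d : {ffun 'I_n -> T}) :
  reflect (forall i k : 'I_n, i./2 = k./2 -> d i = d k) (paired d).
Proof.
apply: (iffP forallP) => [h i k ik|h i].
  by move: (h i) => /forallP /(_ k) /implyP h'; apply/eqP/h'/eqP.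
by apply/forallP => k; apply/implyP => /eqP ik; apply/eqP/h.
Qed.

(** Since [n] is even, no pair straddles the cut. The nested [ffun] is the form that unfolding
    [tcast] and [tprod] produces. *)
Lemma paired_cat (T : eqType) (n p : nat) (e : (n + n)%N = p) (d : {ffun 'I_p -> T}) :
  ~~ odd n ->
  paired d = paired [ffun i => [ffun i => d (cast_ord e i)] (lshift n i)] &&
             paired [ffun i => [ffun i => d (cast_ord e i)] (rshift n i)].
Proof.
move=> n_even; apply/pairedP/andP => [h|[/pairedP hl /pairedP hr] i k].
  by split; apply/pairedP => i k ik; rewrite !ffunE; apply: h => /=;
     rewrite ?halfD ?(negPf n_even) ?ik.
rewrite -[i](cast_ordKV e) -[k](cast_ordKV e).
case: (split_ordP (cast_ord (esym e) i)) => i' ->;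
  case: (split_ordP (cast_ord (esym e) k)) => k' -> /= ik.
- by have := hl i' k' ik; rewrite !ffunE.
- by have := ltn_ord i'; move: ik n_even; lia.
- by have := ltn_ord k'; move: ik n_even; lia.
- by have := hr i' k'; rewrite !ffunE; apply; move: ik n_even; lia.
Qed.

End Pairing.

(** * A parameter choice with an explicit tensor *)

Section Witness.
Variables (R : realType) (L M Y : nat) (r : nat -> nat) (w : nat -> nat -> nat -> nat -> R).
Hypothesis r_gt0 : forall l, (l < L)%N -> (0 < r l)%N.

(* With these parameters the tensor is the product over the pairs of adjacent
   modes of an identity matrix. *)
Definition witness (t : nat * nat * nat * nat) : R :=
  let: (l, j, g, a) := t in
  if l == 0%N then (g == a)%:R else if l == 1%N then 1 else (a == 0%N)%:R.

Hypothesis w_witness :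
  forall l j g a, pvalid L M Y r (l, j, g, a) -> w l j g a = witness (l, j, g, a).

(** At level 1, summing the product of [a == d i0] and [a == d i1] over [a] gives [d i0 == d i1], as
    the entries of [d] are below [r 0]. Higher up, the weights select [a = 0] and the two halves
    multiply. *)
Lemma htensor_witness l j g (d : {ffun 'I_(2 ^ l.+1) -> 'I_M}) :
  (l < L)%N -> (j < 2 ^ (L - l.+1))%N -> (g < if l.+1 == L then Y else r l.+1)%N ->
  (forall i, d i < r 0%N)%N ->
  htensor M r w l.+1 j g d = (paired d)%:R.
Proof.
have lt_child k i : (k < L -> i < 2 ^ (L - k.+1) -> (2 * i).+1 < 2 ^ (L - k))%N.
  by move=> kL ik; rewrite -subnSK // expnS; lia.
elim: l j g d => [|l IH] j g d lL jL gr dr.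
  have e0 : (0 < 2 ^ 1)%N by [].
  have e1 : (1 < 2 ^ 1)%N by [].
  pose i0 := Ordinal e0; pose i1 := Ordinal e1.
  have {}lt_child := lt_child 0%N j lL jL; rewrite subn0 in lt_child.
  have -> : paired d = (d i0 == d i1).
    apply/pairedP/eqP => [h|h i k _]; first exact: h.
    have ord2 m : m = i0 \/ m = i1.
      by case: m => -[|[|m]] hm //; [left|right]; apply: val_inj.
    by case: (ord2 i) => ->; case: (ord2 k) => ->.
  rewrite -[LHS]/(\sum_(a < r 0%N) _).
  rewrite (eq_bigr (fun a : 'I_(r 0) => (a == d i0 :> nat)%:R * (a == d i1 :> nat)%:R)).
    rewrite (bigD1 (Ordinal (dr i0))) //= big1 => [|a /negPf ha].
      by rewrite addr0 eqxx mul1r.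
    by move: ha; rewrite -val_eqE /= => ->; rewrite mul0r.
  move=> a _; rewrite /tprod /= !ffunE.
  rewrite [cast_ord _ _](_ : _ = i0); last exact: val_inj.
  rewrite [cast_ord _ (rshift _ _)](_ : _ = i1); last exact: val_inj.
  rewrite !w_witness /= ?mul1r // ?lL ?jL ?gr ?ltn_ord ?andbT //; first exact: ltnW.
have even_l : ~~ odd (2 ^ l.+1) by rewrite oddX.
rewrite (paired_cat (expn2S l.+1)) //.
rewrite -[LHS]/(\sum_(a < r l.+1) w l.+2 j g a *
  tprod (htensor M r w l.+1 (2 * j) a) (htensor M r w l.+1 (2 * j).+1 a)
        [ffun i => d (cast_ord (expn2S l.+1) i)]).
move: (htensor M r w l.+1) IH => H IH.
have lt_odd := lt_child _ _ lL jL; have lt_even := ltnW lt_odd.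
have ll : (l < L)%N by exact: ltnW.
rewrite (bigD1 (Ordinal (r_gt0 lL))) //= big1 ?addr0 => [|a a0]; last first.
  rewrite w_witness /= ?lL ?jL ?gr ?ltn_ord //.
  by move: a0; rewrite -val_eqE /= => /negPf ->; rewrite mul0r.
rewrite w_witness /= ?lL ?jL ?gr ?r_gt0 // mul1r /tprod.
have gl : (0 < if l.+1 == L then Y else r l.+1)%N by rewrite ltn_eqF // r_gt0.
by rewrite !IH // -?natrM ?mulnb // => i; rewrite !ffunE.
Qed.

End Witness.

(** * Flattening a tensor along even and odd modes *)

Section Matricization.
Variables (R : realType) (M s m : nat) (sM : (s <= M)%N).

Lemma half_ord_subproof (i : 'I_(2 ^ m.+1)) : (i./2 < 2 ^ m)%N.
Proof. by have := ltn_ord i; have := expnS 2 m; lia. Qed.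

Definition half_ord (i : 'I_(2 ^ m.+1)) : 'I_(2 ^ m) := Ordinal (half_ord_subproof i).

Let row_index : finType := {ffun 'I_(2 ^ m) -> 'I_s}.

Definition interleave (u v : row_index) : {ffun 'I_(2 ^ m.+1) -> 'I_M} :=
  [ffun i : 'I_(2 ^ m.+1) =>
     widen_ord sM (if odd i then v (half_ord i) else u (half_ord i))].

Lemma paired_interleave u v : paired (interleave u v) = (u == v).
Proof.
apply/pairedP/eqP => [h|-> i k ik].
  apply/ffunP => i.
  have i0 : (i.*2 < 2 ^ m.+1)%N by have := ltn_ord i; have := expnS 2 m; lia.
  have i1 : (i.*2.+1 < 2 ^ m.+1)%N by have := ltn_ord i; have := expnS 2 m; lia.
  have e0 : half_ord (Ordinal i0) = i by apply: val_inj; rewrite /= doubleK.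
  have e1 : half_ord (Ordinal i1) = i by apply: val_inj; rewrite /= uphalf_double.
  have := h (Ordinal i0) (Ordinal i1); rewrite !ffunE e0 e1 /= odd_double.
  by rewrite uphalf_double doubleK => /(_ erefl) /(congr1 val) /= ?; apply: val_inj.
have e : half_ord i = half_ord k by exact: val_inj.
by rewrite !ffunE e !if_same.
Qed.

Definition matricize (A : tensor R M (2 ^ m.+1)) : 'M[R]_#|row_index| :=
  \matrix_(u, v) A (interleave (enum_val u) (enum_val v)).

(** In each elementary tensor the even modes see only the row and the odd modes only the column, so
    the matrix factors through dimension [cp_rank A], too small for it to be invertible. *)
Lemma det_matricize_eq0 (A : tensor R M (2 ^ m.+1)) :
  (cp_rank A < s ^ (2 ^ m))%N -> \det (matricize A) = 0.
Proof.
move=> rkA; apply/eqP; apply: contraTT rkA => detA; rewrite -leqNgt.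
have [v Av] := @cp_decomp_cp_rank R M _ A (expn_gt0 2 m.+1).
pose F z (u : row_index) b := \prod_(i < 2 ^ m.+1 | odd i == b)
  v z i (widen_ord sM (u (half_ord i))).
pose P := \matrix_(u < #|row_index|, z < cp_rank A) F z (enum_val u) false.
pose Q := \matrix_(z < cp_rank A, u < #|row_index|) F z (enum_val u) true.
have AE : matricize A = P *m Q.
  apply/matrixP => u u'; rewrite !mxE Av; apply: eq_bigr => z _; rewrite !mxE /F.
  rewrite (bigID (fun i : 'I_(2 ^ m.+1) => odd i == false)) /=; congr (_ * _).
    by apply: eq_bigr => i /eqP oi; rewrite ffunE oi.
  rewrite (eq_bigl (fun i : 'I_(2 ^ m.+1) => odd i == true)); last by move=> i; case: odd.
  by apply: eq_bigr => i /eqP oi; rewrite ffunE oi.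
have : \rank (matricize A) = #|row_index| by apply: mxrank_unit; rewrite unitmxE unitfE.
have -> : (s ^ 2 ^ m)%N = #|row_index| by rewrite card_ffun !card_ord.
move=> <-; rewrite AE; exact: leq_trans (mxrankM_maxl _ _) (rank_leq_col _).
Qed.

End Matricization.

(** * Coordinates of the parameter space *)

Section ParameterSpace.
Variable R : realType.

Lemma pget_val n P (p : pidx n P -> R) l j g a (t : pidx n P) :
  tnat (val t) = (l, j, g, a) -> pget p l j g a = p t.
Proof.
case: t => -[[[l' j'] g'] a'] /= Pt [<- <- <- <-].
by rewrite /pget !valK /= insubT.
Qed.

Lemma pidx_exists n (P : pred (nat * nat * nat * nat)) l j g a :
  P (l, j, g, a) -> (l < n)%N -> (j < n)%N -> (g < n)%N -> (a < n)%N ->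
  exists t : pidx n P, tnat (val t) = (l, j, g, a).
Proof.
move=> Pt ln jn gn an.
by exists (exist _ (Ordinal ln, Ordinal jn, Ordinal gn, Ordinal an) Pt).
Qed.

Lemma polyfun_pget n P l j g a : polyfun (fun p : pidx n P -> R => pget p l j g a).
Proof.
rewrite /pget.
do 4 (case: insub => [?|]; last exact: polyfun_cst).
by case: insub => [t|] /=; [exact: polyfun_coord | exact: polyfun_cst].
Qed.

Lemma polyfun_htensor (I : finType) M r (w : (I -> R) -> nat -> nat -> nat -> nat -> R) l j g d :
  (forall l j g a, polyfun (fun p => w p l j g a)) ->
  polyfun (fun p => htensor M r (w p) l j g d).
Proof.
move=> wP; elim: l j g d => [|l IH] j g d; first exact: wP.
apply: (@polyfun_sum _ _ _ _ _ (fun (a : 'I_(r l)) p => w p l.+1 j g a *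
  tprod (htensor M r (w p) l (2 * j) a) (htensor M r (w p) l (2 * j).+1 a) _)) => a.
by apply: polyfunM (wP _ _ _ _) _; apply: polyfunM (IH _ _ _) (IH _ _ _).
Qed.

(** Ensures that the finite index box behind [pidx] cuts off no genuine parameter. *)
Lemma pvalid_lt_pbound L M Y r l j g a : (0 < L)%N -> pvalid L M Y r (l, j, g, a) ->
  [/\ l < pbound L M Y r, j < pbound L M Y r, g < pbound L M Y r & a < pbound L M Y r]%N.
Proof.
move=> L0; have Llt := ltn_expl L (isT : 1 < 2)%N.
have rs k : (k < L)%N -> (r k <= \sum_(l < L) r l)%N.
  by move=> kL; rewrite (bigD1 (Ordinal kL)) //= leq_addr.
have es : (2 ^ (L - l) <= 2 ^ L)%N by rewrite leq_exp2l // leq_subr.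
rewrite /pvalid /pbound; case: eqP => [->|/eqP l0] .
  move=> /and3P[? ? ?].
  by have := rs 0%N L0; split; lia.
case/and4P => lL jl gl al.
have al' : (a < \sum_(l < L) r l)%N by apply: leq_trans al (rs _ _); lia.
have gl' : (g < Y + \sum_(l < L) r l)%N.
  move: gl; case: eqP => [_|lnL gl]; first by lia.
  by apply: leq_trans gl _; apply: leq_trans (leq_addl _ _); apply: rs; lia.
by split; lia.
Qed.

End ParameterSpace.

(** The parametrization [w] is an arbitrary polynomial one, so that the full and the shared settings
    are both instances; [p0] is a point realizing the witness. *)
Lemma lebesgue_null_cp_rank_htensor (R : realType) (I : finType) (i0 : I) L M Y r y
    (w : (I -> R) -> nat -> nat -> nat -> nat -> R) (p0 : I -> R) :
  (1 <= L)%N -> (forall l, l < L -> 0 < r l)%N -> (y < Y)%N ->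
  (forall l j g a, polyfun (fun p => w p l j g a)) ->
  (forall l j g a, pvalid L M Y r (l, j, g, a) -> w p0 l j g a = witness R (l, j, g, a)) ->
  lebesgue_null (fun p =>
    (cp_rank (htensor M r (w p) L 0 y) < minn (r 0%N) M ^ (2 ^ L %/ 2))%N).
Proof.
case: L => // m _ r0 yY wP wE.
have -> : (2 ^ m.+1 %/ 2 = 2 ^ m)%N by rewrite expnS mulKn.
have sM : (minn (r 0%N) M <= M)%N by rewrite geq_minr.
pose f p := \det (matricize sM (htensor M r (w p) m.+1 0 y)).
apply: (@lebesgue_nullS _ _ _ (fun p => f p = 0)) => [p|].
  exact: det_matricize_eq0.
apply: (@lebesgue_null_polyfun _ _ i0 _ p0).
  apply: polyfun_det => u v.
  have [q hq] := @polyfun_htensor R I M r w m.+1 0 y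
    (interleave sM (enum_val u) (enum_val v)) wP.
  by exists q => x; rewrite mxE hq.
rewrite /f [matricize _ _](_ : _ = 1%:M) ?det1 ?oner_eq0 //.
apply/matrixP => u v; rewrite !mxE (htensor_witness r0 wE) //.
- by rewrite paired_interleave (inj_eq enum_val_inj).
- by rewrite subnn.
- by rewrite eqxx.
- by move=> i; rewrite ffunE /=; apply: leq_trans (ltn_ord _) (geq_minl _ _).
Qed.

Theorem theorem1 (R : realType) (L M Y : nat) (r : nat -> nat) (y : nat) :
  (1 <= L)%N ->
  (forall l, (l < L)%N -> (0 < r l)%N) ->
  (y < Y)%N ->
  lebesgue_null (fun p : full_params L M Y r -> R =>
     (cp_rank (Ay_full p y) < minn (r 0%N) M ^ (2 ^ L %/ 2))%N)
  /\
  lebesgue_null (fun p : shared_params L M Y r -> R =>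
     (cp_rank (Ay_shared p y) < minn (r 0%N) M ^ (2 ^ L %/ 2))%N).
Proof.
move=> L1 r0 yY.
have Y0 : (0 < Y)%N by apply: leq_ltn_trans yY.
(* This top-layer entry provides the coordinate [i0]. *)
have top : pvalid L M Y r (L, 0, 0, 0)%N.
  by rewrite /= gtn_eqF // leqnn subnn eqxx Y0 r0 // ltn_predL.
have top_shared : pvalid_shared L M Y r (L, 0, 0, 0)%N.
  by rewrite /= gtn_eqF // leqnn eqxx Y0 r0 // ltn_predL.
have [lb jb gb ab] := pvalid_lt_pbound L1 top.
split.
  have [i0 _] := pidx_exists top lb jb gb ab.
  apply: (@lebesgue_null_cp_rank_htensor R _ i0 L M Y r y
    (fun p l j g a => pget p l j g a) (fun t => witness R (tnat (val t)))) => //.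
    by move=> l j g a; apply: polyfun_pget.
  move=> l j g a v; have [lb' jb' gb' ab'] := pvalid_lt_pbound L1 v.
  by have [t tE] := pidx_exists v lb' jb' gb' ab'; rewrite (pget_val _ tE) tE.
have [i0 _] := pidx_exists top_shared lb jb gb ab.
apply: (@lebesgue_null_cp_rank_htensor R _ i0 L M Y r y
  (fun p l j g a => pget p l 0 g a) (fun t => witness R (tnat (val t)))) => //.
  by move=> l j g a; apply: polyfun_pget.
move=> l j g a v; have [lb' jb' gb' ab'] := pvalid_lt_pbound L1 v.
(* [witness] ignores [j], so the shared coordinate stored at [j = 0] serves every node of the
   layer. *)
have vs : pvalid_shared L M Y r (l, 0, g, a)%N.
  by move: v; rewrite /=; case: ifP => _ => [/and3P[_ -> ->]|/and4P[-> _ -> ->]].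
by have [t tE] := pidx_exists vs lb' jb gb' ab'; rewrite (pget_val _ tE) tE.
Qed.
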